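(* Let $\pi_p$ be any probability on $\{0,\dots,p\}$ and $g$ any probability density on $\mathbb R$ symmetric about $0$, and let $\Pi$ be the prior described below. Then there is a universal constant $C$ such that for any $\beta^0,\beta^*\in\mathbb R^p$ and $r\ge1$, \[ \mathbb E_{\beta^0}\Pi\Big(\beta:\|X(\beta-\beta^0)\|_2>7\|X(\beta^*-\beta^0)\|_2+4\sqrt{\log(C_\pi^2D_{\beta^*})}+8\sqrt r\ \Big|\ Y\Big)\le Ce^{-r}. \]
   Context: Observations follow $Y=X\beta+\varepsilon$ with $X$ a deterministic real $n\times p$ matrix and $\varepsilon\sim N_n(0,I_n)$; $\mathbb E_{\beta^0}$ is expectation when $Y\sim N_n(X\beta^0,I_n)$. $S_\beta=\{i:\beta_i\ne0\}$, $\beta_S=(\beta_i)_{i\in S}$. Prior $\Pi$ on $\mathbb R^p$: draw $s\sim\pi_p$, then $S$ uniform among subsets of $\{1,\dots,p\}$ of size $s$, then $\beta_i$, $i\in S$, i.i.d. with density $g$, $\beta_i=0$ for $i\notin S$. Posterior $\Pi(B\mid Y)=\int_Be^{-\|Y-X\beta\|_2^2/2}d\Pi(\beta)/\int e^{-\|Y-X\beta\|_2^2/2}d\Pi(\beta)$. $C_\pi=\sum_{s=0}^p9^s\binom ps^{1/2}\sqrt{\pi_p(s)}$. For $S\subset\{1,\dots,p\}$ let $G_S$ be the probability measure on $\mathbb R^S$ with density $\prod_{i\in S}g(\beta_i)$. For $\beta\in\mathbb R^p$ with $S=S_\beta$, $s=|S|$, \[ D_\beta=\frac{\binom ps}{\pi_p(s)}\exp\Big(\mathrm{KL}\big(G_S(\cdot-\beta_S),G_S\big)+\tfrac12\int\|Xb_S\|_2^2\,dG_S(b_S)\Big),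 \] where $G_S(\cdot-\beta_S)$ is $G_S$ shifted by $\beta_S$, $\mathrm{KL}$ is the Kullback–Leibler divergence, and $Xb_S$ denotes $X$ applied to the vector in $\mathbb R^p$ equal to $b_S$ on $S$ and $0$ off $S$. *)

(* Defs.v *)
From HB Require Import structures.
From mathcomp Require Import all_boot all_order all_algebra.
From mathcomp Require Import all_classical all_reals all_analysis.
Set Implicit Arguments. Unset Strict Implicit. Unset Printing Implicit Defensive.
Import Order.TTheory GRing.Theory Num.Theory.
Local Open Scope ring_scope.

Section Defs.
Variable R : realType.

Definition sqnorm (n : nat) (v : 'cV[R]_n) : R := \sum_(i < n) (v i ord0) ^+ 2.
Definition nrm (n : nat) (v : 'cV[R]_n) : R := Num.sqrt (sqnorm v).

(* Iterated Lebesgue integral over the coordinates listed in l of a function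
   of a point v : nat -> R; coordinates not in l keep their value in v0.
   For nonnegative measurable integrands this is (Tonelli) the integral
   w.r.t. Lebesgue measure on R^l. *)
Fixpoint iint (l : seq nat) (f : (nat -> R) -> \bar R) (v0 : nat -> R) : \bar R :=
  if l is i :: l' then
    (\int[@lebesgue_measure R]_(x in setT)
        iint l' f (fun j => if j == i then x else v0 j))%E
  else f v0.

Definition vec (p : nat) (v : nat -> R) : 'cV[R]_p := \col_(i < p) v i.

Definition int_on (p : nat) (S : {set 'I_p}) (F : 'cV[R]_p -> \bar R) : \bar R :=
  iint [seq val i | i <- enum S] (fun v => F (vec p v)) (fun _ => 0).

(* Integral of h against the prior Pi (pi, g): draw s ~ pi, S uniform of size s,
   beta_i iid g on S, 0 off S. *)
Definition prior_int (p : nat) (pi : nat -> R) (g : R -> R)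
    (h : 'cV[R]_p -> \bar R) : \bar R :=
  (\sum_(S : {set 'I_p})
     ((pi #|S| / ('C(p, #|S|))%:R)%:E *
      int_on S (fun b => h b * (\prod_(i in S) g (b i ord0))%:E)))%E.

Definition lik (n p : nat) (X : 'M[R]_(n, p)) (Y : 'cV[R]_n) (b : 'cV[R]_p) : R :=
  expR (- (sqnorm (Y - X *m b)) / 2).

Definition posterior (n p : nat) (X : 'M[R]_(n, p)) (pi : nat -> R) (g : R -> R)
    (B : set 'cV[R]_p) (Y : 'cV[R]_n) : R :=
  fine (prior_int pi g (fun b => ((\1_B b) * lik X Y b)%:E)) /
  fine (prior_int pi g (fun b => (lik X Y b)%:E)).

Definition gauss_dens (n : nat) (m y : 'cV[R]_n) : R :=
  expR (- (sqnorm (y - m)) / 2) / (Num.sqrt (2 * pi)) ^+ n.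

Definition expect (n p : nat) (X : 'M[R]_(n, p)) (beta0 : 'cV[R]_p)
    (F : 'cV[R]_n -> R) : \bar R :=
  iint (iota 0 n)
    (fun v => (F (vec n v) * gauss_dens (X *m beta0) (vec n v))%:E) (fun _ => 0).

Definition Cpi (p : nat) (pi : nat -> R) : R :=
  \sum_(s < p.+1) 9 ^+ s * Num.sqrt ('C(p, s))%:R * Num.sqrt (pi s).

Definition supp (p : nat) (b : 'cV[R]_p) : {set 'I_p} := [set i | b i ord0 != 0].

(* integrand of the KL divergence KL(P,Q) = int fP log(fP/fQ), with the usual
   conventions 0 log(0/q) = 0 and a log(a/0) = +oo for a > 0 *)
Definition klf (a b : R) : \bar R :=
  if a == 0 then 0%E else if b == 0 then +oo%E else (a * ln (a / b))%:E.

(* KL( G_S(. - beta_S), G_S ) = int f^+ - int f^-  (Lebesgue integral of a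
   signed function, f = klf of the two product densities on R^S) *)
Definition KL_shift (p : nat) (g : R -> R) (S : {set 'I_p}) (beta : 'cV[R]_p) : \bar R :=
  let f := fun b : 'cV[R]_p =>
    klf (\prod_(i in S) g (b i ord0 - beta i ord0)) (\prod_(i in S) g (b i ord0)) in
  (int_on S (fun b => maxe (f b) 0) - int_on S (fun b => maxe (- f b) 0))%E.

Definition Dbeta (n p : nat) (X : 'M[R]_(n, p)) (pi : nat -> R) (g : R -> R)
    (beta : 'cV[R]_p) : \bar R :=
  let S := supp beta in
  let s := #|S| in
  if pi s == 0 then +oo%E else
  ((('C(p, s))%:R / pi s)%:E *
   expeR (KL_shift g S beta +
          (2^-1)%:E * int_on S (fun b => (sqnorm (X *m b) *
                                          \prod_(i in S) g (b i ord0))%:E)))%E.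

(* sqrt (log x) extended to \bar R (x >= 1 in our use) *)
Definition sqrt_log (x : \bar R) : \bar R :=
  match x with
  | EFin r => (Num.sqrt (ln r))%:E
  | +oo%E => +oo%E
  | -oo%E => 0%E
  end.

End Defs.

(* Main.v *)
Require Import Defs.
From HB Require Import structures.
From mathcomp Require Import all_boot all_order all_algebra.
From mathcomp Require Import all_classical all_reals all_analysis.
From mathcomp Require Import measurable_realfun.
From mathcomp Require Import ring lra.
Set Implicit Arguments.
Unset Strict Implicit.
Unset Printing Implicit Defensive.
Import Order.TTheory GRing.Theory Num.Theory.
Local Open Scope ring_scope.

(** Denominator.  By Jensen's inequality against the density g_S(. - betas_S),
    S = supp betas, and the symmetry of g (which cancels the linear term), for
    every Y
      int exp(-|Y - X b|^2 / 2) dPi(b) >= exp(-|Y - X betas|^2 / 2) / D.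

    Numerator.  Write eps = Y - X beta0, mu = X (b - beta0),
    nu = X (b - betas), c = |X (betas - beta0)|.  The part q_S of the posterior
    mass carried by a model S lies in [0, 1], hence is at most sqrt(q_S).  On
    the event |mu| > M with M >= 7 c one has |nu|^2 <= (64/49) |mu|^2, and nu
    stays in the space spanned by X betas and the columns of X in S, of
    dimension at most |S| + 1.  If (e_k) is an orthonormal basis of it and
    u_k = <e_k, eps>, then <nu, eps> - |nu|^2 / 3 <= (3/4) sum_k u_k^2, whence
      sqrt(q_S) <= sqrt(w_S D) exp(c^2/4 - M^2/32) exp((3/8) sum_k u_k^2),
    where w_S is the prior probability of S.  The expectation of the last factor is
    2^(dimension) <= 2 * 9^|S|, and the sum of 9^|S| sqrt(w_S) over S is C_pi,
    so the constant 2 works. *)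

(** * Iterated Lebesgue integrals: comparison, Tonelli, change of variables *)

Section IteratedIntegral.
Local Open Scope classical_set_scope.
Variable R : realType.
Local Open Scope ereal_scope.
Local Notation mu := (@lebesgue_measure R).
Implicit Types (f h : (nat -> R) -> \bar R) (v : nat -> R) (l : seq nat).

(** The integral of a nonnegative function is a supremum over the simple functions below it, and
    those below [f] are also below [h]. No measurability enters, so the posterior can be integrated
    in Y without proving that it is measurable in Y. *)
Lemma ge0_le_integral_nomeas (f h : R -> \bar R) :
  (forall x, 0 <= f x) -> (forall x, f x <= h x) ->
  \int[mu]_(x in setT) f x <= \int[mu]_(x in setT) h x.
Proof.
move=> f0 fh; have h0 x : 0 <= h x by exact: le_trans (f0 x) (fh x).
rewrite !ge0_integralTE//; apply: ereal_sup_le => _ [k kf <-].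
by exists k => // x; exact: le_trans (kf x) (fh x).
Qed.

Definition upd v (i : nat) (x : R) : nat -> R :=
  fun j => if j == i then x else v j.

Lemma upd_eq v i x : upd v i x i = x.
Proof. by rewrite /upd eqxx. Qed.

Lemma upd_neq v i x j : j != i -> upd v i x j = v j.
Proof. by rewrite /upd => /negbTE ->. Qed.

Lemma updC v i j x y : i != j -> upd (upd v i x) j y = upd (upd v j y) i x.
Proof.
move=> ij; apply/funext => k; rewrite /upd.
by case: (eqVneq k j) => [->|//]; rewrite eq_sym (negbTE ij).
Qed.

Lemma iint_cons i l f v :
  iint (i :: l) f v = \int[mu]_(x in setT) iint l f (upd v i x).
Proof. by []. Qed.

(* Measurability with respect to the coordinates, phrased through test maps so
   that no sigma-algebra on [nat -> R] is needed. *)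
Definition cmeas f : Prop :=
  forall d (T : measurableType d) (c : T -> nat -> R),
    (forall i, measurable_fun setT (fun t => c t i)) ->
    measurable_fun setT (f \o c).

Lemma iint_ge0 l f v : (forall w, 0 <= f w) -> 0 <= iint l f v.
Proof.
move=> f0; elim: l v => [|i l IH] v //=.
by apply: integral_ge0 => x _; exact: IH.
Qed.

(** Only points that agree with [v] off [l] are ever visited, so the comparison is asked only there.
    This is what later restricts attention to vectors vanishing off a support set. *)
Lemma iint_le l f h v :
  (forall w, (forall j, j \notin l -> w j = v j) -> 0 <= f w <= h w) ->
  iint l f v <= iint l h v.
Proof.
move=> fh; suff: 0 <= iint l f v <= iint l h v by case/andP.
elim: l v fh => [|i l IH] v fh; first exact: fh.
have {}IH x : 0 <= iint l f (upd v i x) <= iint l h (upd v i x).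
  apply: IH => w wv; apply: fh => j; rewrite inE negb_or => /andP[ji jl].
  by rewrite wv// upd_neq.
rewrite !iint_cons; apply/andP; split.
  by apply: integral_ge0 => x _; have /andP[] := IH x.
by apply: ge0_le_integral_nomeas => x; have /andP[] := IH x.
Qed.

Lemma eq_iint l f h v :
  (forall w, (forall j, j \notin l -> w j = v j) -> f w = h w) ->
  iint l f v = iint l h v.
Proof.
elim: l v => [|i l IH] v fh; first exact: fh.
rewrite !iint_cons; apply: eq_integral => x _.
apply: IH => w wv; apply: fh => j; rewrite inE negb_or => /andP[ji jl].
by rewrite wv// upd_neq.
Qed.

Lemma iint_cat l1 l2 f v : iint (l1 ++ l2) f v = iint l1 (iint l2 f) v.
Proof.
elim: l1 v => [|i l IH] v //; rewrite cat_cons !iint_cons.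
by apply: eq_integral => x _; rewrite IH.
Qed.

Lemma measurable_upd d (T : measurableType d) (c : T -> nat -> R) i :
  (forall j, measurable_fun setT (fun t => c t j)) ->
  forall j, measurable_fun setT (fun z : T * R => upd (c z.1) i z.2 j).
Proof.
move=> mc j; rewrite /upd; case: (j == i).
  exact: measurable_snd.
exact: (measurableT_comp (mc j) measurable_fst).
Qed.

Lemma measurable_upd1 v i j : measurable_fun setT (fun x : R => upd v i x j).
Proof. by rewrite /upd; case: (j == i). Qed.

(** The arbitrary test space in [cmeas] pays off here: the induction hypothesis is used on the
    product of [T] with the line, and Tonelli makes the partial integral measurable on [T]. *)
Lemma cmeas_iint l f : (forall w, 0 <= f w) -> cmeas f -> cmeas (iint l f).
Proof.
move=> f0 mf; elim: l => [//|i l IH] d T c mc.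
apply: (@measurable_fun_fubini_tonelli_F _ _ T _ R mu
  (fun z => iint l f (upd (c z.1) i z.2))) => [|z].
  by apply: IH; exact: measurable_upd.
exact: iint_ge0.
Qed.

Lemma cmeas_iint_upd l f v i : (forall w, 0 <= f w) -> cmeas f ->
  measurable_fun setT (fun x : R => iint l f (upd v i x)).
Proof.
move=> f0 mf.
exact: (@cmeas_iint l f f0 mf _ _ (upd v i) (measurable_upd1 v i)).
Qed.

Lemma iintD l f h v : (forall w, 0 <= f w) -> (forall w, 0 <= h w) ->
  cmeas f -> cmeas h ->
  iint l (fun w => f w + h w) v = iint l f v + iint l h v.
Proof.
move=> f0 h0 mf mh; elim: l v => [//|i l IH] v; rewrite !iint_cons.
under eq_integral do rewrite IH.
rewrite ge0_integralD//; try exact: cmeas_iint_upd;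
  by move=> x _; exact: iint_ge0.
Qed.

Lemma iintZ l f v (k : R) : (0 <= k)%R -> (forall w, 0 <= f w) -> cmeas f ->
  iint l (fun w => k%:E * f w) v = k%:E * iint l f v.
Proof.
move=> k0 f0 mf; elim: l v => [//|i l IH] v; rewrite !iint_cons.
under eq_integral do rewrite IH.
rewrite ge0_integralZl_EFin//; last exact: cmeas_iint_upd.
by move=> x _; exact: iint_ge0.
Qed.

Lemma iint0 l v : iint l (fun=> 0) v = 0 :> \bar R.
Proof.
elim: l v => [//|i l IH] v; rewrite iint_cons.
by under eq_integral do rewrite IH; rewrite integral0.
Qed.

Lemma cmeas_sum (I : Type) (s : seq I) (F : I -> (nat -> R) -> \bar R) :
  (forall i, cmeas (F i)) -> cmeas (fun w => \sum_(i <- s) F i w).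
Proof. by move=> mF d T c mc; apply: emeasurable_sum => i; exact: mF. Qed.

Lemma iint_sum l (I : Type) (s : seq I) (F : I -> (nat -> R) -> \bar R) v :
  (forall i w, 0 <= F i w) -> (forall i, cmeas (F i)) ->
  iint l (fun w => \sum_(i <- s) F i w) v = \sum_(i <- s) iint l (F i) v.
Proof.
move=> F0 mF; elim: s => [|i s IH].
  rewrite big_nil -[RHS](iint0 l v); apply: eq_iint => w _; exact: big_nil.
rewrite big_cons -IH -iintD//.
- by apply: eq_iint => w _; rewrite big_cons.
- by move=> w; exact: sume_ge0.
- exact: cmeas_sum.
Qed.

Lemma iint_swap2 i j l f v : i != j -> (forall w, 0 <= f w) -> cmeas f ->
  iint (i :: j :: l) f v = iint (j :: i :: l) f v.
Proof.
move=> ij f0 mf; rewrite !iint_cons.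
have := @fubini_tonelli _ _ _ _ R mu mu
  (fun z : R * R => iint l f (upd (upd v i z.1) j z.2)).
rewrite /= => ->; first last.
- by move=> z; exact: iint_ge0.
- apply: cmeas_iint => // k.
  by apply: (@measurable_upd _ _ (upd v i)); exact: measurable_upd1.
apply: eq_integral => y _ /=.
by apply: eq_integral => x _; rewrite updC.
Qed.

(** Repeated Tonelli swaps carry the outermost variable to the innermost place. It serves to
    exchange an auxiliary mixing variable with the integral over the observations. *)
Lemma iint_cons_rcons i l f v : i \notin l -> (forall w, 0 <= f w) -> cmeas f ->
  iint (i :: l) f v = iint (rcons l i) f v.
Proof.
move=> + f0 mf; elim: l v => [//|j l IH] v; rewrite inE negb_or => /andP[ij il].
rewrite iint_swap2// rcons_cons !(iint_cons j).
by apply: eq_integral => x _; rewrite IH.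
Qed.

(** The second hypothesis says that each [phi j] preserves Lebesgue measure; translations and the
    reflection are the two uses. The base point is transported as well, since coordinates outside
    [l] are not integrated out. *)
Lemma iint_comp l f (phi : nat -> R -> R) v :
  (forall j, measurable_fun setT (phi j)) ->
  (forall j (k : R -> \bar R), (forall x, 0 <= k x) -> measurable_fun setT k ->
     \int[mu]_(x in setT) k (phi j x) = \int[mu]_(x in setT) k x) ->
  (forall w, 0 <= f w) -> cmeas f ->
  iint l (fun w => f (fun j => phi j (w j))) v = iint l f (fun j => phi j (v j)).
Proof.
move=> mphi iphi f0 mf; elim: l v => [//|i l IH] v; rewrite !iint_cons.
under eq_integral do rewrite IH.
rewrite -(iphi i (fun x => iint l f (upd (fun j => phi j (v j)) i x))).
- apply: eq_integral => x _; congr iint; apply/funext => j; rewrite /upd.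
  by case: eqP => // ->.
- by move=> x; exact: iint_ge0.
- exact: cmeas_iint_upd.
Qed.

Lemma iint_prod l (psi : nat -> R -> R) (k : nat -> R) v : uniq l ->
  (forall i x, 0 <= psi i x)%R -> (forall i, measurable_fun setT (psi i)) ->
  (forall i, \int[mu]_(x in setT) (psi i x)%:E = (k i)%:E) ->
  iint l (fun w => (\prod_(i <- l) psi i (w i))%:E) v = (\prod_(i <- l) k i)%:E.
Proof.
move=> + p0 mp ip; elim: l v => [|i l IH] v; first by rewrite /= !big_nil.
move=> /andP[il ul]; rewrite iint_cons.
have E x : iint l (fun w => (\prod_(j <- i :: l) psi j (w j))%:E) (upd v i x) =
    (\prod_(j <- l) k j)%:E * (psi i x)%:E.
  rewrite -(IH (upd v i x))// muleC -iintZ//.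
  - apply: eq_iint => w wv; rewrite big_cons EFinM; congr (_%:E * _).
    by rewrite wv// upd_eq.
  - by move=> w; rewrite lee_fin prodr_ge0.
  - move=> d T c mc; apply/measurable_EFinP.
    by apply: measurable_prod => j _; exact: (measurableT_comp (mp j) (mc j)).
under eq_integral do rewrite E.
rewrite ge0_integralZl_EFin//.
- by rewrite ip big_cons -EFinM mulrC.
- by move=> x _; rewrite lee_fin.
- by apply/measurable_EFinP; exact: mp.
- apply: prodr_ge0 => j _; rewrite -lee_fin -ip.
  by apply: integral_ge0 => x _; rewrite lee_fin.
Qed.

(** The image of Lebesgue measure under a translation gives each half-open interval its length,
    hence is Lebesgue measure by uniqueness. *)
Lemma integral_shift (a : R) (k : R -> \bar R) : (forall x, 0 <= k x) ->
  measurable_fun setT k ->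
  \int[mu]_(x in setT) k (x - a)%R = \int[mu]_(x in setT) k x.
Proof.
move=> k0 mk.
pose phi (x : measurableTypeR R) : measurableTypeR R := (x - a)%R.
have mphi : measurable_fun setT phi by exact: measurable_funB.
have E (A : set R) : measurable A -> mu A = pushforward mu phi A.
  apply: (lebesgue_measure_unique (mu := pushforward mu phi)).
  move=> _ [[b c]] _ <-; rewrite /pushforward/=.
  transitivity (mu `](b + a)%R, (c + a)%R]); last first.
    congr (mu _); apply/seteqP.
    by split => x /=; rewrite !in_itv/= ltrBrDr lerBlDr.
  rewrite !lebesgue_measure_itv/= !lte_fin ltrD2r.
  by case: ifP => // _; rewrite -!EFinB; congr EFin; ring.
transitivity (\int[pushforward mu phi]_(x in setT) k x).
  by rewrite ge0_integral_pushforward.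
by apply: eq_measure_integral => A mA _; exact/esym/E.
Qed.

Lemma integral_opp (k : R -> \bar R) : (forall x, 0 <= k x) ->
  measurable_fun setT k ->
  \int[mu]_(x in setT) k (- x)%R = \int[mu]_(x in setT) k x.
Proof.
move=> k0 mk.
transitivity (\int[pushforward mu
  (-%R : _ -> measurableTypeR R)]_(x in setT) k x).
  by rewrite ge0_integral_pushforward.
by apply: eq_measure_integral => A mA _; exact: lebesgue_measureN.
Qed.

End IteratedIntegral.

(** * Euclidean geometry: orthonormal families and two quadratic inequalities *)

Section Euclidean.
Variables (R : realType) (n : nat).
Implicit Types (a b e w : 'cV[R]_n) (es vs : seq 'cV[R]_n).

Definition dot a b : R := \sum_(i < n) a i ord0 * b i ord0.

Lemma dotC a b : dot a b = dot b a.
Proof. by apply: eq_bigr => i _; rewrite mulrC. Qed.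

Lemma dotDl a b w : dot (a + b) w = dot a w + dot b w.
Proof. by rewrite -big_split; apply: eq_bigr => i _; rewrite mxE mulrDl. Qed.

Lemma dotZl (k : R) a w : dot (k *: a) w = k * dot a w.
Proof. by rewrite mulr_sumr; apply: eq_bigr => i _; rewrite mxE mulrA. Qed.

Lemma dotDr a b w : dot w (a + b) = dot w a + dot w b.
Proof. by rewrite dotC dotDl !(dotC w). Qed.

Lemma dotZr (k : R) a w : dot w (k *: a) = k * dot w a.
Proof. by rewrite dotC dotZl (dotC w). Qed.

Lemma dotNl a w : dot (- a) w = - dot a w.
Proof. by rewrite -scaleN1r dotZl mulN1r. Qed.

Lemma dotNr a w : dot w (- a) = - dot w a.
Proof. by rewrite dotC dotNl (dotC w). Qed.

Lemma dot0l w : dot 0 w = 0.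
Proof. by rewrite /dot big1// => i _; rewrite mxE mul0r. Qed.

Lemma dot_suml (I : Type) (s : seq I) (F : I -> 'cV[R]_n) w :
  dot (\sum_(i <- s) F i) w = \sum_(i <- s) dot (F i) w.
Proof.
elim: s => [|i s IH]; first by rewrite !big_nil dot0l.
by rewrite !big_cons dotDl IH.
Qed.

Lemma sqnormE w : sqnorm w = dot w w.
Proof. by apply: eq_bigr => i _; rewrite expr2. Qed.

Lemma sqnorm_ge0 w : 0 <= sqnorm w.
Proof. by apply: sumr_ge0 => i _; exact: sqr_ge0. Qed.

Lemma sqnorm_eq0 w : (sqnorm w == 0) = (w == 0).
Proof.
apply/eqP/eqP => [w0|->]; last by rewrite sqnormE dot0l.
apply/matrixP => i j; rewrite (ord1 j) mxE; apply/eqP; rewrite -sqrf_eq0.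
apply/eqP; apply: (psumr_eq0P _ w0) => // k _; exact: sqr_ge0.
Qed.

(** The recursive form lets an induction on the list split off one unit vector orthogonal to all the
    remaining ones. *)
Fixpoint orthonormal es : Prop :=
  if es is e :: es' then
    [/\ dot e e = 1, {in es', forall e', dot e e' = 0} & orthonormal es']
  else True.

(** For an orthonormal list this is membership in its linear span, expressed by the Fourier
    expansion of [w]. *)
Definition spanned es w := w = \sum_(e <- es) dot w e *: e.

Lemma spannedD es a b : spanned es a -> spanned es b -> spanned es (a + b).
Proof.
rewrite /spanned => {1}-> {1}->; rewrite -big_split; apply: eq_bigr => e _.
by rewrite dotDl scalerDl.
Qed.

Lemma spannedZ es (k : R) a : spanned es a -> spanned es (k *: a).
Proof.
rewrite /spanned => {1}->; rewrite scaler_sumr; apply: eq_bigr => e _.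
by rewrite dotZl scalerA.
Qed.

Lemma spanned0 es : spanned es 0.
Proof. by rewrite /spanned big1// => e _; rewrite dot0l scale0r. Qed.

Lemma spanned_sum es (I : Type) (s : seq I) (P : pred I) (F : I -> 'cV[R]_n) :
  (forall i, P i -> spanned es (F i)) -> spanned es (\sum_(i <- s | P i) F i).
Proof.
by move=> sF; apply: big_ind => //; [exact: spanned0|exact: spannedD].
Qed.

Lemma spanned_dot es a b : spanned es a ->
  dot a b = \sum_(e <- es) dot a e * dot e b.
Proof.
by move=> {1}->; rewrite dot_suml; apply: eq_bigr => e _; rewrite dotZl.
Qed.

Lemma orthonormal_dot_sum es (k : 'cV[R]_n -> R) :
  orthonormal es -> uniq es ->
  {in es, forall e', dot (\sum_(e <- es) k e *: e) e' = k e'}.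
Proof.
elim: es => [//|e es IH] /= [e1 e0 oes] /andP[ees ues] e'.
rewrite inE big_cons dotDl dotZl => /predU1P[->|e'es].
  rewrite e1 mulr1 dot_suml big1_seq ?addr0// => f /andP[_ fes].
  by rewrite dotZl dotC e0// mulr0.
by rewrite (e0 _ e'es) mulr0 add0r IH.
Qed.

(** Gram-Schmidt: subtract from [v] its projection on the family built so far and normalise the
    remainder [u]. If [u] is zero no vector is added, hence an inequality between the sizes. *)
Lemma exists_orthonormal vs : exists es,
  [/\ (size es <= size vs)%N, uniq es, orthonormal es &
      {in vs, forall w, spanned es w}].
Proof.
elim: vs => [|v vs [es [ses ues oes spes]]]; first by exists [::].
pose u := v - \sum_(e <- es) dot v e *: e.
have u0 : {in es, forall e, dot u e = 0}.
  by move=> e ees; rewrite dotDl dotNl orthonormal_dot_sum// subrr.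
have [u_eq0|u_neq0] := eqVneq u 0.
  exists es; split => //; first exact: leqW.
  move=> w; rewrite inE => /predU1P[->|/spes//].
  by apply/eqP; rewrite -subr_eq0; apply/eqP.
have su_gt0 : 0 < sqnorm u by rewrite lt_def sqnorm_eq0 u_neq0 sqnorm_ge0.
pose k := Num.sqrt (sqnorm u).
have k_gt0 : 0 < k by rewrite sqrtr_gt0.
have k_neq0 : k != 0 by rewrite gt_eqF.
have kk : k * k = sqnorm u by rewrite -expr2 sqr_sqrtr// ltW.
pose e0 := k^-1 *: u.
have e01 : dot e0 e0 = 1.
  by rewrite dotZl dotZr -sqnormE -kk; field.
have e00 : {in es, forall e, dot e0 e = 0}.
  by move=> e /u0 ue; rewrite dotZl ue mulr0.
exists (e0 :: es); split => //=.
- rewrite ues andbT; apply/negP => /e00; rewrite e01 => /eqP.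
  by rewrite oner_eq0.
- move=> w; rewrite inE => /predU1P[->|wvs].
    have vE : v = u + \sum_(e <- es) dot v e *: e by rewrite subrK.
    have ve0 : dot v e0 = k.
      rewrite {1}vE dotDl dot_suml big1_seq ?addr0 => [|e /andP[_ ees]].
        by rewrite dotZr -sqnormE -kk mulrA mulVf// mul1r.
      by rewrite dotZl (dotC e) e00// mulr0.
    by rewrite /spanned big_cons ve0 scalerA divff// scale1r.
  have we0 : dot w e0 = 0.
    rewrite (spanned_dot _ (spes _ wvs)) big1_seq// => e /andP[_ ees].
    by rewrite (dotC e) e00// mulr0.
  by rewrite /spanned big_cons we0 scale0r add0r; exact: spes.
Qed.

(* Completing the square coordinatewise in an orthonormal basis. *)
Lemma spanned_dot_le es a b : spanned es a ->
  dot a b - sqnorm a / 3 <= 3 / 4 * \sum_(e <- es) dot e b ^+ 2.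
Proof.
move=> sa; rewrite sqnormE !(spanned_dot _ sa) mulr_suml mulr_sumr -sumrB.
apply: ler_sum => e _; rewrite (dotC e a).
have := sqr_ge0 (dot a e - 3 / 2 * dot e b); lra.
Qed.

(** The difference of the two sides is the squared norm of a + 7b divided by 7. When 49 |b|^2 <=
    |a|^2 the right side is at most 64/49 |a|^2. *)
Lemma sqnormB_le a b :
  sqnorm (a - b) <= 8 / 7 * sqnorm a + 8 * sqnorm b.
Proof.
rewrite !mulr_sumr -big_split/=; apply: ler_sum => i _; rewrite !mxE.
have := sqr_ge0 (a i ord0 + 7 * b i ord0); lra.
Qed.

Lemma sqnormB a b : sqnorm (a - b) = sqnorm a - 2 * dot a b + sqnorm b.
Proof.
by rewrite !sqnormE dotDl !dotDr !dotNl !dotNr (dotC b a); ring.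
Qed.

End Euclidean.

(** * Measurability of real functions of the coordinates *)

Section RealMeasurable.
Local Open Scope classical_set_scope.
Variable R : realType.
Implicit Types F G : (nat -> R) -> R.

Definition rmeas F : Prop :=
  forall d (T : measurableType d) (c : T -> nat -> R),
    (forall i, measurable_fun setT (fun t => c t i)) ->
    measurable_fun setT (F \o c).

Lemma cmeas_EFin F : rmeas F -> cmeas (fun v => (F v)%:E).
Proof. by move=> mF d T c mc; apply/measurable_EFinP; exact: mF. Qed.

Lemma rmeas_coord i : rmeas (fun v => v i).
Proof. by move=> d T c; apply. Qed.

Lemma rmeas_cst (k : R) : rmeas (fun=> k).
Proof. by move=> d T c mc; exact: measurable_cst. Qed.

Lemma rmeas_comp (h : R -> R) F : measurable_fun setT h -> rmeas F ->
  rmeas (fun v => h (F v)).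
Proof. by move=> mh mF d T c mc; exact: (measurableT_comp mh (mF _ _ _ mc)). Qed.

Lemma rmeasD F G : rmeas F -> rmeas G -> rmeas (fun v => F v + G v).
Proof. by move=> mF mG d T c mc; apply: measurable_funD; [exact: mF|exact: mG]. Qed.

Lemma rmeasB F G : rmeas F -> rmeas G -> rmeas (fun v => F v - G v).
Proof. by move=> mF mG d T c mc; apply: measurable_funB; [exact: mF|exact: mG]. Qed.

Lemma rmeasM F G : rmeas F -> rmeas G -> rmeas (fun v => F v * G v).
Proof. by move=> mF mG d T c mc; apply: measurable_funM; [exact: mF|exact: mG]. Qed.

Lemma rmeasX F k : rmeas F -> rmeas (fun v => F v ^+ k).
Proof. by move=> mF d T c mc; apply: measurable_funX; exact: mF. Qed.

Lemma rmeas_sum (I : Type) (s : seq I) (F : I -> (nat -> R) -> R) :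
  (forall i, rmeas (F i)) -> rmeas (fun v => \sum_(i <- s) F i v).
Proof. by move=> mF d T c mc; apply: measurable_sum => i; exact: mF. Qed.

Lemma rmeas_prod (I : eqType) (s : seq I) (F : I -> (nat -> R) -> R) :
  (forall i, rmeas (F i)) -> rmeas (fun v => \prod_(i <- s) F i v).
Proof. by move=> mF d T c mc; apply: measurable_prod => i _; exact: mF. Qed.

Lemma rmeas_expR F : rmeas F -> rmeas (fun v => expR (F v)).
Proof. by apply: rmeas_comp; exact: measurable_expR. Qed.

Lemma rmeas_vecB n (m : 'cV[R]_n) i :
  rmeas (fun v => (vec n v - m) i ord0).
Proof.
have -> : (fun v => (vec n v - m) i ord0) = (fun v : nat -> R => v i - m i ord0).
  by apply/funext => v; rewrite !mxE.
by apply: rmeasB; [exact: rmeas_coord|exact: rmeas_cst].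
Qed.

Lemma rmeas_dot n (a m : 'cV[R]_n) : rmeas (fun v => dot a (vec n v - m)).
Proof.
apply: rmeas_sum => i; apply: rmeasM; first exact: rmeas_cst.
exact: rmeas_vecB.
Qed.

Lemma rmeas_sqnorm n (F : (nat -> R) -> 'cV[R]_n) :
  (forall i, rmeas (fun v => F v i ord0)) -> rmeas (fun v => sqnorm (F v)).
Proof. by move=> mF; apply: rmeas_sum => i; exact: rmeasX. Qed.

Lemma rmeas_gauss_dens n (m : 'cV[R]_n) :
  rmeas (fun v => gauss_dens m (vec n v)).
Proof.
apply: rmeasM; last exact: rmeas_cst.
apply: rmeas_expR; apply: rmeasM; last exact: rmeas_cst.
apply: (rmeas_comp (h := fun x => - x)); first exact: oppr_measurable.
by apply: rmeas_sqnorm; exact: rmeas_vecB.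
Qed.

End RealMeasurable.

(** * Gaussian integrals and exponential moments *)

Section Gaussian.
Local Open Scope classical_set_scope.
Variable R : realType.
Local Notation mu := (@lebesgue_measure R).

(** Completing the square turns the integrand into a multiple of the normal density with mean b/(2a)
    and variance 1/(2a). *)
Lemma gauss_integral_lin (a b : R) : 0 < a ->
  (\int[mu]_(x in setT) (expR (b * x - a * x ^+ 2))%:E =
   (Num.sqrt (pi / a) * expR (b ^+ 2 / (4 * a)))%:E)%E.
Proof.
move=> a0; have an0 : a != 0 by rewrite gt_eqF.
pose s := Num.sqrt ((2 * a)^-1).
have s2 : s ^+ 2 = (2 * a)^-1 by rewrite sqr_sqrtr// invr_ge0; lra.
have sn0 : s != 0 by rewrite gt_eqF// sqrtr_gt0 invr_gt0; lra.
have pa0 : 0 < pi / a by rewrite divr_gt0// pi_gt0.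
have E x : expR (b * x - a * x ^+ 2) =
    (Num.sqrt (pi / a) * expR (b ^+ 2 / (4 * a))) * normal_pdf (b / (2 * a)) s x.
  rewrite normal_pdfE// /normal_peak /normal_fun s2.
  rewrite (_ : (2 * a)^-1 * pi *+ 2 = pi / a); last by rewrite mulr2n; field.
  rewrite mulrACA divff ?gt_eqF ?sqrtr_gt0// mul1r -expRD; congr expR.
  by rewrite mulr2n; field; rewrite an0/=; lra.
under eq_integral do rewrite E EFinM.
rewrite ge0_integralZl_EFin//.
- by rewrite integral_normal_pdf// mule1.
- by move=> x _; rewrite lee_fin normal_pdf_ge0.
- by apply/measurable_EFinP; exact: measurable_normal_pdf.
Qed.

(** Both the exponential and the Gaussian density factor over the coordinates, so the Laplace
    transform is a product of one-dimensional integrals. *)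
Lemma expect_exp_dot n (a m : 'cV[R]_n) (v0 : nat -> R) :
  iint (iota 0 n) (fun v => (expR (dot a (vec n v - m)) *
     gauss_dens m (vec n v))%:E) v0 = (expR (sqnorm a / 2))%:E.
Proof.
(* Vectors are extended by 0 to all natural indices, as [iint_prod] needs a factor for every
   index. *)
pose ext (w : 'cV[R]_n) i := if insub i is Some j then w j ord0 else 0.
have extE w (i : 'I_n) : ext w i = w i ord0 by rewrite /ext valK.
pose psi i x := expR (ext a i * (x - ext m i) - 2^-1 * (x - ext m i) ^+ 2) /
   Num.sqrt (2 * pi).
have mpsi i : measurable_fun setT (psi i).
  apply: measurable_funM => //; apply: measurableT_comp => //.
  apply: measurable_funB; first by apply: measurable_funM => //; exact: measurable_funB.
  by apply: measurable_funM => //; apply: measurable_funX; exact: measurable_funB.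
transitivity (iint (iota 0 n) (fun v => (\prod_(i <- iota 0 n) psi i (v i))%:E) v0).
  apply: eq_iint => v _; congr EFin.
  have -> : iota 0 n = index_iota 0 n by rewrite /index_iota subn0.
  rewrite big_mkord /psi big_split/= prodr_const card_ord exprVn.
  rewrite -expR_sum /gauss_dens mulrA -expRD; congr (expR _ / _).
  rewrite mulNr (mulrC (sqnorm _)) mulr_sumr -sumrB; apply: eq_bigr => i _.
  by rewrite !mxE !extE.
rewrite (iint_prod (k := fun i => expR (ext a i ^+ 2 / 2))) ?iota_uniq//.
- have -> : iota 0 n = index_iota 0 n by rewrite /index_iota subn0.
  rewrite big_mkord -expR_sum; congr (expR _)%:E; rewrite mulr_suml.
  by apply: eq_bigr => i _; rewrite extE.
- by move=> i x; rewrite divr_ge0 ?sqrtr_ge0 ?expR_ge0.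
- move=> i; pose k x := (expR (ext a i * x - 2^-1 * x ^+ 2))%:E.
  have mk : measurable_fun setT k.
    apply/measurable_EFinP; apply: measurableT_comp => //.
    by apply: measurable_funB; apply: measurable_funM => //; exact: measurable_funX.
  have E x : (psi i x)%:E = (((Num.sqrt (2 * pi))^-1)%:E * k (x - ext m i)%R)%E.
    by rewrite muleC.
  under eq_integral do rewrite E.
  rewrite ge0_integralZl_EFin ?invr_ge0 ?sqrtr_ge0//; last 2 first.
  + by move=> x _; rewrite lee_fin expR_ge0.
  + by apply: (measurableT_comp mk); exact: measurable_funB.
  rewrite (integral_shift (ext m i) (k := k))//; last first.
    by move=> x; rewrite lee_fin expR_ge0.
  rewrite gauss_integral_lin; last lra.
  rewrite invrK (mulrC pi) -EFinM mulrA mulVf ?mul1r; last first.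
    by rewrite gt_eqF// sqrtr_gt0 mulr_gt0// pi_gt0.
  by congr (expR _)%:E; field.
Qed.

(** The coefficient 3/8 is half of the 3/4 in [spanned_dot_le], because a square root of the
    posterior mass is taken. The linear term makes the induction of the next lemma go through; it is
    applied with [a] = 0. *)
Definition chisq_exp n (es : seq 'cV[R]_n) (a w : 'cV[R]_n) : R :=
  expR (3 / 8 * (\sum_(e <- es) dot e w ^+ 2) + dot a w).

(** In one direction, with Z standard normal and t real, E exp(3/8 Z^2 + t Z) = 2 exp(2 t^2). The
    induction linearises one square at a time, replacing [a] by a + x e, which leaves its inner
    products with the other vectors unchanged. *)
Lemma expect_chisq_exp n (m : 'cV[R]_n) (es : seq 'cV[R]_n) (a : 'cV[R]_n)
    (v0 : nat -> R) :
  orthonormal es ->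
  iint (iota 0 n) (fun v => (chisq_exp es a (vec n v - m) *
     gauss_dens m (vec n v))%:E) v0 =
  (2 ^+ size es * expR (sqnorm a / 2 + 3 / 2 * \sum_(e <- es) dot a e ^+ 2))%:E.
Proof.
elim: es a v0 => [|e es IH] a v0 /=.
  rewrite big_nil expr0 mul1r mulr0 addr0 => _; rewrite -(expect_exp_dot a m v0).
  by apply: eq_iint => v _; rewrite /chisq_exp big_nil mulr0 add0r.
move=> [e1 e0 oes].
(* exp(3/8 u^2) is a Gaussian mixture of exp(l u) *)
pose q := Num.sqrt (3 / 2 * pi : R).
have q0 : 0 < q by rewrite sqrtr_gt0 mulr_gt0 ?pi_gt0//; lra.
have qn0 : q != 0 by rewrite gt_eqF.
(* The mixing variable is stored in coordinate [n], outside [iota 0 n]. The weight fits since the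
   integral of exp(u x - 2/3 x^2) over x is q exp(3/8 u^2). *)
pose H v := (expR (- (2 / 3) * v n ^+ 2) *
   (chisq_exp es (a + v n *: e) (vec n v - m) * gauss_dens m (vec n v)))%:E.
have H0 v : (0 <= H v)%E.
  by rewrite lee_fin !mulr_ge0 ?expR_ge0 ?invr_ge0 ?exprn_ge0 ?sqrtr_ge0.
have mH : cmeas H.
  apply: cmeas_EFin; apply: rmeasM.
    apply: rmeas_expR; apply: rmeasM; first exact: rmeas_cst.
    by apply: rmeasX; exact: rmeas_coord.
  apply: rmeasM; last exact: rmeas_gauss_dens.
  apply: rmeas_expR; apply: rmeasD.
    apply: rmeasM; first exact: rmeas_cst.
    by apply: rmeas_sum => f; apply: rmeasX; exact: rmeas_dot.
  rewrite (_ : (fun _ => _) = fun v =>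
    dot a (vec n v - m) + v n * dot e (vec n v - m)).
    apply: rmeasD; first exact: rmeas_dot.
    by apply: rmeasM; [exact: rmeas_coord|exact: rmeas_dot].
  by apply/funext => v; rewrite dotDl dotZl.
have nl : n \notin iota 0 n by rewrite mem_iota add0n ltnn.
have vec_upd v x : vec n (upd v n x) = vec n v.
  by apply/matrixP => i j; rewrite !mxE upd_neq// ltn_eqF.
transitivity ((q^-1)%:E * iint (rcons (iota 0 n) n) H v0)%E.
  rewrite -cats1 iint_cat -iintZ ?invr_ge0 ?ltW//; last 2 first.
  - by move=> w; exact: iint_ge0.
  - exact: cmeas_iint.
  apply: eq_iint => v _; rewrite iint_cons /=.
  set u := dot e (vec n v - m).
  set K := chisq_exp es a (vec n v - m) * gauss_dens m (vec n v).
  have K0 : 0 <= K by rewrite !mulr_ge0 ?expR_ge0 ?invr_ge0 ?exprn_ge0 ?sqrtr_ge0.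
  have E x : H (upd v n x) = (K%:E * (expR (u * x - 2 / 3 * x ^+ 2))%:E)%E.
    rewrite /H /K vec_upd upd_eq -EFinM; congr EFin.
    rewrite mulrA [RHS]mulrAC; congr (_ * _); rewrite /chisq_exp -!expRD.
    by congr expR; rewrite dotDl dotZl -/u; ring.
  under eq_integral do rewrite E.
  rewrite ge0_integralZl_EFin//; last first.
  - apply/measurable_EFinP; apply: measurableT_comp => //.
    by apply: measurable_funB; apply: measurable_funM => //; exact: measurable_funX.
  rewrite gauss_integral_lin; last lra.
  rewrite -!EFinM; congr EFin.
  have -> : Num.sqrt (pi / (2 / 3)) = q by congr Num.sqrt; field.
  rewrite [RHS](_ : _ = K * expR (u ^+ 2 / (4 * (2 / 3)))); last by field.
  rewrite /K [RHS]mulrAC; congr (_ * _).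
  rewrite /chisq_exp -expRD big_cons -/u; congr expR; by field.
(* With the mixing variable now outermost, the induction hypothesis applies for each fixed value x
   of it. *)
rewrite -iint_cons_rcons// iint_cons.
pose w := dot a e.
pose K := 2 ^+ size es * expR (sqnorm a / 2 + 3 / 2 * \sum_(f <- es) dot a f ^+ 2).
(* Expanding |a + x e|^2 / 2 contributes w x + x^2 / 2, and 1/2 - 2/3 = -1/6. *)
have E x : iint (iota 0 n) H (upd v0 n x) =
    (K%:E * (expR (w * x - 6^-1 * x ^+ 2))%:E)%E.
  transitivity ((expR (- (2 / 3) * x ^+ 2))%:E *
    iint (iota 0 n) (fun v => (chisq_exp es (a + x *: e) (vec n v - m) *
       gauss_dens m (vec n v))%:E) (upd v0 n x))%E.
    rewrite -iintZ ?expR_ge0//.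
    - apply: eq_iint => v vE; rewrite /H EFinM.
      by rewrite vE// upd_eq.
    - by move=> v; rewrite lee_fin !mulr_ge0 ?expR_ge0 ?invr_ge0 ?exprn_ge0 ?sqrtr_ge0.
    - apply: cmeas_EFin; apply: rmeasM; last exact: rmeas_gauss_dens.
      apply: rmeas_expR; apply: rmeasD; last exact: rmeas_dot.
      apply: rmeasM; first exact: rmeas_cst.
      by apply: rmeas_sum => f; apply: rmeasX; exact: rmeas_dot.
  rewrite IH// -!EFinM; congr EFin; rewrite mulrCA -[RHS]mulrA; congr (_ * _).
  rewrite -!expRD; congr expR.
  have -> : \sum_(f <- es) dot (a + x *: e) f ^+ 2 = \sum_(f <- es) dot a f ^+ 2.
    apply: eq_big_seq => f fes; rewrite dotDl dotZl.
    by rewrite (e0 _ fes) mulr0 addr0.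
  rewrite !sqnormE dotDl !dotDr !dotZl !dotZr e1 (dotC e a) -/w.
  by field.
under eq_integral do rewrite E.
rewrite ge0_integralZl_EFin//; last 2 first.
- apply/measurable_EFinP; apply: measurableT_comp => //.
  by apply: measurable_funB; apply: measurable_funM => //; exact: measurable_funX.
- by rewrite mulr_ge0 ?expR_ge0 ?exprn_ge0.
rewrite gauss_integral_lin; last lra.
rewrite -!EFinM; congr EFin.
(* This is the factor 2 gained for each vector of the family. *)
have -> : Num.sqrt (pi / 6^-1) = 2 * q.
  rewrite -[X in X * q]ger0_norm// -sqrtr_sqr -sqrtrM ?sqr_ge0//; congr Num.sqrt.
  by field.
rewrite [LHS](_ : _ = 2 * K * expR (w ^+ 2 / (4 * 6^-1))); last by field.
rewrite /K mulrA -exprS -mulrA -expRD big_cons -/w; congr (_ * expR _).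
by field.
Qed.

End Gaussian.

(** * Integration over the coordinates of a support set *)

Lemma iint_indep (R : realType) l (f : (nat -> R) -> \bar R) v w :
  (forall j, j \notin l -> v j = w j) -> iint l f v = iint l f w.
Proof.
elim: l v w => [|i l IH] v w vw; first by congr f; apply/funext => j; exact: vw.
rewrite !iint_cons; apply: eq_integral => x _; apply: IH => j jl.
rewrite /upd; case: (eqVneq j i) => // ji.
by apply: vw; rewrite inE negb_or ji.
Qed.

Section IntOn.
Local Open Scope classical_set_scope.
Variables (R : realType) (p : nat).
Implicit Types (S : {set 'I_p}) (F G : 'cV[R]_p -> \bar R) (b : 'cV[R]_p).

Lemma notin_enum S (j : 'I_p) :
  (val j \notin [seq val i | i <- enum S]) = (j \notin S).
Proof. by rewrite mem_map ?mem_enum//; exact: val_inj. Qed.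

Lemma int_on_le S F G :
  (forall b, (forall i, i \notin S -> b i ord0 = 0) -> (0 <= F b <= G b)%E) ->
  (int_on S F <= int_on S G)%E.
Proof.
move=> FG; apply: iint_le => w w0; apply: FG => i iS.
by rewrite mxE w0// notin_enum.
Qed.

Lemma eq_int_on S F G :
  (forall b, F b = G b) -> int_on S F = int_on S G.
Proof. by move=> FG; apply: eq_iint => w _; exact: FG. Qed.

Lemma int_on_ge0 S F : (forall b, (0 <= F b)%E) -> (0 <= int_on S F)%E.
Proof. by move=> F0; apply: iint_ge0 => w. Qed.

Definition vmeas F := cmeas (fun v => F (vec p v)).

Lemma vmeasD F G : vmeas F -> vmeas G -> vmeas (fun b => F b + G b)%E.
Proof. by move=> mF mG d T c mc; apply: emeasurable_funD; [exact: mF|exact: mG]. Qed.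

Lemma vmeasZ F (k : R) : vmeas F -> vmeas (fun b => k%:E * F b)%E.
Proof. by move=> mF d T c mc; apply: measurable_funeM; exact: mF. Qed.

Lemma int_onD S F G : (forall b, (0 <= F b)%E) -> (forall b, (0 <= G b)%E) ->
  vmeas F -> vmeas G ->
  (int_on S (fun b => F b + G b) = int_on S F + int_on S G)%E.
Proof. by move=> F0 G0 mF mG; exact: iintD. Qed.

Lemma int_onZ S F (k : R) : 0 <= k -> (forall b, (0 <= F b)%E) -> vmeas F ->
  (int_on S (fun b => k%:E * F b) = k%:E * int_on S F)%E.
Proof. by move=> k0 F0 mF; exact: iintZ. Qed.

(** The change of variables moves the base point from 0 to -b. As [b] vanishes off [S], the two
    differ only in coordinates that are integrated out. *)
Lemma int_on_shift S F b : (forall i, i \notin S -> b i ord0 = 0) ->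
  (forall c, (0 <= F c)%E) -> vmeas F ->
  int_on S (fun c => F (c - b)) = int_on S F.
Proof.
move=> b0 F0 mF.
pose ext i := if insub i is Some j then b j ord0 else 0.
have extE (i : 'I_p) : ext i = b i ord0 by rewrite /ext valK.
transitivity (iint [seq val i | i <- enum S] (fun v => F (vec p v))
    (fun j => 0 - ext j)); last first.
  apply: iint_indep => j; rewrite /ext; case: insubP => [i _ <-|_ _].
    by rewrite notin_enum => /b0 ->; rewrite subrr.
  by rewrite subrr.
rewrite -(@iint_comp _ _ _ (fun j x => x - ext j)) //.
- apply: eq_iint => w _; congr F; apply/matrixP => i j.
  by rewrite (ord1 j) !mxE extE.
- by move=> j; exact: measurable_funB.
- by move=> j k k0 mk; exact: integral_shift.
Qed.

Lemma int_on_opp S F : (forall c, (0 <= F c)%E) -> vmeas F ->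
  int_on S (fun c => F (- c)) = int_on S F.
Proof.
move=> F0 mF.
transitivity (iint [seq val i | i <- enum S] (fun v => F (vec p v))
    (fun j => - 0)); last by apply: iint_indep => j _; rewrite oppr0.
rewrite -(@iint_comp _ _ _ (fun j x => - x)) //.
- apply: eq_iint => w _; congr F; apply/matrixP => i j.
  by rewrite !mxE.
- by move=> j; exact: oppr_measurable.
- by move=> j k k0 mk; exact: integral_opp.
Qed.

Lemma vmeas_shift F b : vmeas F -> vmeas (fun c => F (c - b)).
Proof.
move=> mF d T c mc.
pose ext i := if insub i is Some j then b j ord0 else 0.
have -> : (fun v => F (vec p v - b)) \o c =
    (fun v => F (vec p v)) \o (fun t i => c t i - ext i).
  apply/funext => t /=; congr F; apply/matrixP => i j.
  by rewrite (ord1 j) !mxE /ext valK.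
by apply: mF => i; exact: measurable_funB.
Qed.

End IntOn.

(** * Pointwise bounds for the Kullback-Leibler integrand *)

Section KullbackLeibler.
Local Open Scope classical_set_scope.
Variable R : realType.
Implicit Types a b : R.

Lemma klfE a b : 0 <= a -> 0 <= b -> klf a b =
  if a == 0 then 0%E else if b == 0 then +oo%E else (a * (ln a - ln b))%:E.
Proof.
move=> a0 b0; rewrite /klf; case: ifPn => // an; case: ifPn => // bn.
by rewrite ln_div// posrE lt_def ?an ?bn.
Qed.

Lemma measurable_klf d (T : measurableType d) (a b : T -> R) :
  (forall t, 0 <= a t) -> (forall t, 0 <= b t) ->
  measurable_fun setT a -> measurable_fun setT b ->
  measurable_fun setT (fun t => klf (a t) (b t)).
Proof.
move=> a0 b0 ma mb.
have -> : (fun t => klf (a t) (b t)) = (fun t => if a t == 0 then 0%E else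
    if b t == 0 then +oo%E else (a t * (ln (a t) - ln (b t)))%:E).
  by apply/funext => t; exact: klfE.
apply: measurable_fun_ifT; [exact: measurable_fun_eqr|exact: measurable_cst|].
apply: measurable_fun_ifT; [exact: measurable_fun_eqr|exact: measurable_cst|].
apply/measurable_EFinP; apply: measurable_funM => //.
by apply: measurable_funB; apply: measurableT_comp => //; exact: measurable_ln.
Qed.

(** From ln x <= x - 1 one gets -a ln(a/b) <= b - a <= b. Hence the negative part in [KL_shift] has
    integral at most 1 and the difference there is never of the form oo - oo. *)
Lemma klf_neg_le a b : 0 <= a -> 0 <= b -> (maxe (- klf a b) 0 <= b%:E)%E.
Proof.
move=> a0 b0; rewrite ge_max lee_fin b0 andbT klfE//.
case: eqVneq => [_|an]; first by rewrite oppe0 lee_fin.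
case: eqVneq => [_|bn]; first by rewrite leNye.
have a1 : 0 < a by rewrite lt_def an.
have b1 : 0 < b by rewrite lt_def bn.
rewrite -EFinN lee_fin -ln_div ?posrE// -mulrN -lnV ?posrE ?divr_gt0// invf_div.
have h : ln (b / a) <= b / a - 1.
  have := @le_ln1Dx R (b / a - 1); rewrite addrCA subrr addr0; apply.
  by rewrite ltrBDr addrC subrr divr_gt0.
apply: (@le_trans _ _ (a * (b / a - 1))); first by rewrite ler_pM2l.
by rewrite mulrBr mulrCA divff// mulr1; lra.
Qed.

(* Tangent-line form of Jensen's inequality; [M] only keeps the coefficients
   nonnegative, so that both sides can be integrated termwise. *)
Lemma klf_tangent a b (L m M : R) : 0 <= a -> 0 <= b -> 0 <= L -> `|m| <= M ->
  ((1 + M)%:E * a%:E + maxe (- klf a b) 0 <=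
   (expR (- m))%:E * (expR (- L / 2) * b)%:E + (m + M)%:E * a%:E +
   (2^-1)%:E * (L * a)%:E + maxe (klf a b) 0)%E.
Proof.
move=> a0 b0 L0 mM; have mM0 : 0 <= m + M by have := lerNnormlW mM; lra.
rewrite klfE//; case: eqVneq => [->|an].
  rewrite oppe0 maxxx !mulr0 !mule0 !adde0.
  by rewrite -EFinM lee_fin !mulr_ge0 ?expR_ge0.
case: eqVneq => [_|bn].
  by rewrite [X in (_ <= _ + X)%E]maxye// -!EFinM -!EFinD addey// leey.
have a1 : 0 < a by rewrite lt_def an.
have b1 : 0 < b by rewrite lt_def bn.
set f := a * (ln a - ln b).
have fE : Num.max (f) 0 - Num.max (- f) 0 = f.
  by case: (leP f 0) => f0; case: (leP (- f) 0) => f1; lra.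
rewrite -EFinN -!EFin_max -!EFinM -!EFinD lee_fin.
(* The tangent inequality 1 + z <= exp z, to be multiplied by a > 0. *)
have := expR_ge1Dx (- L / 2 - m + ln b - ln a).
have -> : expR (- L / 2 - m + ln b - ln a) = expR (- m) * (expR (- L / 2) * b) / a.
  by rewrite expRB expRD expRD !lnK ?posrE// [X in X * b]mulrC !mulrA.
rewrite ler_pdivlMr// => h.
by move: fE h; rewrite /f; lra.
Qed.

End KullbackLeibler.

(** * Lower bound for the marginal likelihood of one model *)

Section Evidence.
Local Open Scope classical_set_scope.
Variables (R : realType) (n p : nat) (X : 'M[R]_(n, p)) (g : R -> R).
Hypothesis mg : measurable_fun setT g.
Hypothesis g0 : forall x, 0 <= g x.
Hypothesis ig : (\int[@lebesgue_measure R]_(x in setT) (g x)%:E = 1)%E.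
Hypothesis sg : forall x, g (- x) = g x.
Implicit Types (S : {set 'I_p}) (b : 'cV[R]_p) (Y W : 'cV[R]_n).

Definition prod_dens S b : R := \prod_(i in S) g (b i ord0).

Lemma prod_dens_ge0 S b : 0 <= prod_dens S b.
Proof. exact: prodr_ge0. Qed.

Lemma rmeas_prod_dens S : rmeas (fun v => prod_dens S (vec p v)).
Proof.
rewrite (_ : (fun _ => _) = fun v : nat -> R => \prod_(i <- enum S) g (v (val i))).
  by apply: rmeas_prod => i; apply: rmeas_comp => //; exact: rmeas_coord.
by apply/funext => v; rewrite big_enum /=; apply: eq_bigr => i _; rewrite mxE.
Qed.

Lemma vmeas_prod_dens S : vmeas (fun b => (prod_dens S b)%:E).
Proof. by apply: cmeas_EFin; exact: rmeas_prod_dens. Qed.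

Lemma int_prod_dens S : int_on S (fun b => (prod_dens S b)%:E) = 1%E.
Proof.
transitivity (iint [seq val i | i <- enum S]
  (fun v => (\prod_(i <- [seq val i | i <- enum S]) g (v i))%:E) (fun=> 0)).
  apply: eq_iint => v _; congr EFin; rewrite big_map big_enum /=.
  by apply: eq_bigr => i _; rewrite mxE.
rewrite (@iint_prod _ _ (fun=> g) (fun=> 1))//; first by rewrite big1.
by rewrite map_inj_uniq ?enum_uniq//; exact: val_inj.
Qed.

Lemma rmeas_residual Y (k : R) : rmeas (fun v => sqnorm (Y + k *: (X *m vec p v))).
Proof.
apply: rmeas_sqnorm => i.
have -> : (fun v => (Y + k *: (X *m vec p v)) i ord0) =
    (fun v : nat -> R => Y i ord0 + k * \sum_(j < p) X i j * v j).
  apply/funext => v; rewrite !mxE; congr (_ + k * _).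
  by apply: eq_bigr => j _; rewrite mxE.
apply: rmeasD; first exact: rmeas_cst.
apply: rmeasM; first exact: rmeas_cst.
apply: rmeas_sum => j; apply: rmeasM; first exact: rmeas_cst.
exact: rmeas_coord.
Qed.

Lemma rmeas_residualB Y : rmeas (fun v => sqnorm (Y - X *m vec p v)).
Proof.
have := rmeas_residual Y (-1).
by under [X in rmeas X]eq_fun do rewrite scaleN1r.
Qed.

Lemma lik_ge0 Y b : 0 <= lik X Y b.
Proof. exact: expR_ge0. Qed.

Lemma lik_le1 Y b : lik X Y b <= 1.
Proof.
by rewrite -expR0 ler_expR mulNr oppr_le0 divr_ge0// sqnorm_ge0.
Qed.

Lemma rmeas_lik Y : rmeas (fun v => lik X Y (vec p v)).
Proof.
apply: rmeas_expR; apply: rmeasM; last exact: rmeas_cst.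
apply: (rmeas_comp (h := fun x => - x)); first exact: oppr_measurable.
exact: rmeas_residualB.
Qed.

(** The marginal likelihood of the model [S], with the factors arranged so that it is literally the
    term of [S] in [prior_int]. *)
Definition evidence S Y : \bar R :=
  int_on S (fun b => (lik X Y b)%:E * (prod_dens S b)%:E)%E.

Lemma evidence_ge0 S Y : (0 <= evidence S Y)%E.
Proof.
by apply: int_on_ge0 => b; rewrite mule_ge0// lee_fin ?lik_ge0 ?prod_dens_ge0.
Qed.

Lemma evidence_le1 S Y : (evidence S Y <= 1)%E.
Proof.
rewrite -(int_prod_dens S); apply: int_on_le => b _.
rewrite -EFinM !lee_fin mulr_ge0 ?lik_ge0 ?prod_dens_ge0//=.
by rewrite ler_piMl ?prod_dens_ge0// lik_le1.
Qed.

Section Shift.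
Variables (S : {set 'I_p}) (b : 'cV[R]_p).
Hypothesis b0 : forall i, i \notin S -> b i ord0 = 0.

(** Spelled out as products so that it coincides with the integrand inside [KL_shift]. *)
Definition shift_klf (c : 'cV[R]_p) : \bar R :=
  klf (\prod_(i in S) g (c i ord0 - b i ord0)) (\prod_(i in S) g (c i ord0)).

Lemma shift_klfE c : shift_klf c = klf (prod_dens S (c - b)) (prod_dens S c).
Proof.
by rewrite /shift_klf; congr klf; apply: eq_bigr => i _; rewrite !mxE.
Qed.

Lemma vmeas_shift_klf : vmeas shift_klf.
Proof.
move=> d T c mc.
have -> : (fun v => shift_klf (vec p v)) \o c = fun t =>
    klf (prod_dens S (vec p (c t) - b)) (prod_dens S (vec p (c t))).
  by apply/funext => t; exact: shift_klfE.
apply: measurable_klf => [t|t||]; rewrite ?prod_dens_ge0//.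
  by apply/measurable_EFinP; exact: (@vmeas_shift _ _ _ b (vmeas_prod_dens S) _ _ c mc).
exact: (@rmeas_prod_dens S _ _ c mc).
Qed.

Lemma vmeas_shift_klf_pos : vmeas (fun c => maxe (shift_klf c) 0).
Proof.
by move=> d T c mc; apply: measurable_maxe => //; exact: vmeas_shift_klf.
Qed.

Lemma vmeas_shift_klf_neg : vmeas (fun c => maxe (- shift_klf c) 0)%E.
Proof.
move=> d T c mc; apply: measurable_maxe => //.
by apply: measurableT_comp => //; exact: vmeas_shift_klf.
Qed.

Lemma int_shift_klf_neg_le1 : (int_on S (fun c => maxe (- shift_klf c) 0) <= 1)%E.
Proof.
rewrite -(int_prod_dens S); apply: int_on_le => c _.
rewrite le_max lexx orbT/= shift_klfE.
by apply: klf_neg_le; exact: prod_dens_ge0.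
Qed.

(** After translation the integral is that of |W - X c|^2 under G_S, which by symmetry equals that
    of |W + X c|^2. The parallelogram identity gives their sum, so the signed linear term is never
    integrated. *)
Lemma int_residual_shift Y (V : R) :
  int_on S (fun c => (sqnorm (X *m c) * prod_dens S c)%:E) = V%:E ->
  int_on S (fun c => (sqnorm (Y - X *m c) * prod_dens S (c - b))%:E) =
    (sqnorm (Y - X *m b) + V)%:E.
Proof.
move=> VE; set W := Y - X *m b.
pose F (k : R) c := (sqnorm (W + k *: (X *m c)) * prod_dens S c)%:E.
have F0 k c : (0 <= F k c)%E by rewrite lee_fin mulr_ge0 ?sqnorm_ge0 ?prod_dens_ge0.
have mF k : vmeas (F k).
  by apply: cmeas_EFin; apply: rmeasM; [exact: rmeas_residual|exact: rmeas_prod_dens].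
transitivity (int_on S (F (-1))).
  rewrite -(int_on_shift b0 (F0 (-1)) (mF (-1))); apply: eq_int_on => c.
  congr (sqnorm _ * _)%:E.
  by rewrite scaleN1r mulmxBr /W opprB addrA subrK.
have FN : int_on S (F (-1)) = int_on S (F 1).
  rewrite -(int_on_opp S (F0 1) (mF 1)); apply: eq_int_on => c.
  congr (sqnorm _ * _)%:E; first by rewrite mulmxN scaleN1r scale1r.
  by apply: eq_bigr => i _; rewrite mxE sg.
have mX : vmeas (fun c => (sqnorm (X *m c) * prod_dens S c)%:E).
  apply: cmeas_EFin; apply: rmeasM; last exact: rmeas_prod_dens.
  have := rmeas_residual 0 1.
  by under [X in rmeas X]eq_fun do rewrite add0r scale1r.
have X0 c : (0 <= (sqnorm (X *m c) * prod_dens S c)%:E)%E.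
  by rewrite lee_fin mulr_ge0 ?sqnorm_ge0 ?prod_dens_ge0.
have W0 : 0 <= 2 * sqnorm W by rewrite mulr_ge0 ?sqnorm_ge0.
have p0 c : (0 <= (prod_dens S c)%:E)%E by rewrite lee_fin prod_dens_ge0.
have : (int_on S (F (-1)%R) + int_on S (F 1%R) =
    (2 * sqnorm W)%:E * 1 + 2%:E * V%:E)%E.
  rewrite -VE -(int_prod_dens S) -!int_onZ//; last exact: vmeas_prod_dens.
  rewrite -!int_onD//.
  - apply: eq_int_on => c; rewrite /F -!EFinM -!EFinD; congr EFin.
    have -> : W + 1 *: (X *m c) = W - - (X *m c) by rewrite scale1r opprK.
    by rewrite scaleN1r !sqnormB dotNr !sqnormE !dotNl !dotNr opprK; ring.
  - by move=> c; rewrite mule_ge0.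
  - by move=> c; rewrite mule_ge0.
  - by apply: vmeasZ; exact: vmeas_prod_dens.
  - exact: vmeasZ.
rewrite -FN mule1; case: (int_on S _) => [a| |]//=.
by rewrite -EFinM -!EFinD => -[aE]; congr EFin; lra.
Qed.

(** [klf_tangent] is integrated with a the shifted density, b the original one and L = |Y - X c|^2.
    Taking m to be the logarithm of the claimed bound cancels everything except 1 <= exp(-m) times
    the evidence. *)
Lemma evidence_ge Y (V Kp Kn : R) :
  int_on S (fun c => maxe (shift_klf c) 0) = Kp%:E ->
  int_on S (fun c => maxe (- shift_klf c) 0)%E = Kn%:E ->
  int_on S (fun c => (sqnorm (X *m c) * prod_dens S c)%:E) = V%:E ->
  ((expR (- (sqnorm (Y - X *m b)) / 2 - (Kp - Kn + V / 2)))%:E <= evidence S Y)%E.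
Proof.
move=> KpE KnE VE; have LE := int_residual_shift Y VE.
set r2 := sqnorm (Y - X *m b) in LE *.
set m := - r2 / 2 - (Kp - Kn + V / 2).
pose M := `|m|.
have mM0 : 0 <= m + M by have := lerNnormlW (lexx `|m|); rewrite /M; lra.
have p0 c := prod_dens_ge0 S c.
have M1 : 0 <= 1 + M by rewrite addr_ge0 /M ?normr_ge0.
have shift0 c : (0 <= (prod_dens S (c - b))%:E)%E by rewrite lee_fin.
have vmax0 (x : \bar R) : (0 <= maxe x 0)%E by rewrite le_max lexx orbT.
have mshift : vmeas (fun c => (prod_dens S (c - b))%:E).
  exact: vmeas_shift (vmeas_prod_dens S).
have int1 : int_on S (fun c => (prod_dens S (c - b))%:E) = 1%E.
  by rewrite -(int_prod_dens S) -[RHS](int_on_shift b0)//; exact: vmeas_prod_dens.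
have mono : (int_on S (fun c => (1 + M)%:E * (prod_dens S (c - b))%:E +
      maxe (- shift_klf c) 0) <=
    int_on S (fun c => (expR (- m))%:E * (lik X Y c * prod_dens S c)%:E +
      (m + M)%:E * (prod_dens S (c - b))%:E +
      (2^-1)%:E * (sqnorm (Y - X *m c) * prod_dens S (c - b))%:E +
      maxe (shift_klf c) 0))%E.
  apply: int_on_le => c _; apply/andP; split.
    by rewrite adde_ge0 ?mule_ge0.
  by rewrite shift_klfE; apply: klf_tangent; rewrite ?sqnorm_ge0.
move: mono.
have m1 : vmeas (fun c => (lik X Y c * prod_dens S c)%:E).
  by apply: cmeas_EFin; apply: rmeasM; [exact: rmeas_lik|exact: rmeas_prod_dens].
have m2 : vmeas (fun c => (sqnorm (Y - X *m c) * prod_dens S (c - b))%:E).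
  move=> d T c mc; apply/measurable_EFinP; apply: measurable_funM.
    exact: rmeas_residualB.
  by apply/measurable_EFinP; exact: mshift.
have p1 c : (0 <= (lik X Y c * prod_dens S c)%:E)%E.
  by rewrite lee_fin mulr_ge0 ?lik_ge0.
have p2 c : (0 <= (sqnorm (Y - X *m c) * prod_dens S (c - b))%:E)%E.
  by rewrite lee_fin mulr_ge0 ?sqnorm_ge0.
have i2 : 0 <= 2^-1 :> R by [].
have em0 : 0 <= expR (- m) := expR_ge0 _.
have mKp := vmeas_shift_klf_pos; have mKn := vmeas_shift_klf_neg.
have a0 c : (0 <= (1 + M)%:E * (prod_dens S (c - b))%:E)%E by rewrite mule_ge0.
have a1 c : (0 <= (expR (- m))%:E * (lik X Y c * prod_dens S c)%:E)%E.
  by rewrite mule_ge0.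
have a2 c : (0 <= (m + M)%:E * (prod_dens S (c - b))%:E)%E by rewrite mule_ge0.
have a3 c : (0 <= (2^-1)%:E * (sqnorm (Y - X *m c) * prod_dens S (c - b))%:E)%E.
  by rewrite mule_ge0.
rewrite int_onD//; last exact: vmeasZ.
rewrite int_onD//; last 2 first.
- by move=> c; rewrite !adde_ge0.
- by apply: vmeasD; [apply: vmeasD|]; exact: vmeasZ.
rewrite int_onD//; last 3 first.
- by move=> c; rewrite adde_ge0.
- by apply: vmeasD; exact: vmeasZ.
- exact: vmeasZ.
rewrite int_onD//; [|exact: vmeasZ|exact: vmeasZ].
rewrite !int_onZ// int1 LE KpE KnE.
have -> : int_on S (fun c => (lik X Y c * prod_dens S c)%:E) = evidence S Y.
  by apply: eq_int_on => c; rewrite EFinM.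
have := evidence_ge0 S Y; have := evidence_le1 S Y.
case: (evidence S Y) => [e _ e0|//|//].
rewrite !mule1 -!EFinM -!EFinD !lee_fin => h.
have : 1 <= expR (- m) * e by move: h; rewrite /m /r2; lra.
by rewrite expRN mulrC ler_pdivlMr ?expR_gt0// mul1r.
Qed.

End Shift.
End Evidence.

(** * Splitting the posterior mass over the models *)

Section Posterior.
Local Open Scope classical_set_scope.
Variables (R : realType) (n p : nat) (X : 'M[R]_(n, p)).
Variables (pi : nat -> R) (g : R -> R).
Hypothesis pi0 : forall s, (s <= p)%N -> 0 <= pi s.
Hypothesis pi1 : \sum_(s < p.+1) pi s = 1.
Hypothesis mg : measurable_fun setT g.
Hypothesis g0 : forall x, 0 <= g x.
Hypothesis ig : (\int[@lebesgue_measure R]_(x in setT) (g x)%:E = 1)%E.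
Implicit Types (S : {set 'I_p}) (b : 'cV[R]_p) (Y W : 'cV[R]_n).

Definition weight S : R := pi #|S| / ('C(p, #|S|))%:R.

Lemma card_le_p S : (#|S| <= p)%N.
Proof. by rewrite -[X in (_ <= X)%N]card_ord max_card. Qed.

Lemma weight_ge0 S : 0 <= weight S.
Proof. by rewrite divr_ge0 ?ler0n// pi0// card_le_p. Qed.

(** Group the sets by size: with N = 'C(p, s) sets of size s, N sqrt(pi s / N) = sqrt N sqrt(pi
    s). *)
Lemma Cpi_weight : Cpi p pi = \sum_(S : {set 'I_p}) 9 ^+ #|S| * Num.sqrt (weight S).
Proof.
rewrite (partition_big (fun S => inord #|S| : 'I_p.+1) predT)//=.
apply: eq_bigr => s _; have sp : (s <= p)%N by rewrite -ltnS.
have cardE S : (inord #|S| == s) = (#|S| == s).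
  by rewrite -val_eqE/= inordK// ltnS card_le_p.
rewrite (eq_bigl _ _ cardE).
rewrite (eq_bigr (fun=> 9 ^+ s * Num.sqrt (pi s / ('C(p, s))%:R))); last first.
  by move=> S /eqP cS; rewrite /weight cS.
rewrite sumr_const.
have -> : #|[pred S : {set 'I_p} | #|S| == s]| = 'C(p, s).
  by have := card_draws 'I_p s; rewrite card_ord cardsE.
have C0 : 0 < ('C(p, s))%:R :> R by rewrite ltr0n bin_gt0.
rewrite -[RHS]mulr_natr -!mulrA; congr (_ * _).
rewrite mulrC sqrtrM ?pi0// sqrtrV ?ltW// -mulrA; congr (_ * _).
by rewrite -[in X in _ = _ * X](sqr_sqrtr (ltW C0)) expr2 mulKf// gt_eqF// sqrtr_gt0.
Qed.

Lemma Cpi_gt0 : 0 < Cpi p pi.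
Proof.
have t0 (s : 'I_p.+1) : true -> 0 <= 9 ^+ s * Num.sqrt ('C(p, s))%:R * Num.sqrt (pi s).
  by move=> _; rewrite !mulr_ge0 ?sqrtr_ge0 ?exprn_ge0.
rewrite lt_def sumr_ge0 ?andbT//; apply/eqP => /psumr_eq0P C0.
suff : \sum_(s < p.+1) pi s = 0 by rewrite pi1 => /eqP; rewrite oner_eq0.
apply: big1 => s _; have sp : (s <= p)%N by rewrite -ltnS.
have /eqP := C0 t0 s isT.
rewrite !mulf_eq0 expf_eq0 pnatr_eq0 andbF/= !sqrtr_eq0 leNgt ltr0n bin_gt0 sp/= => ps.
by apply/eqP; rewrite eq_le ps pi0.
Qed.

Lemma prior_intE Y : prior_int pi g (fun b => (lik X Y b)%:E) =
  (\sum_(S : {set 'I_p}) (weight S)%:E * evidence X g S Y)%E.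
Proof. by []. Qed.

Lemma fine_evidence S Y : (fine (evidence X g S Y))%:E = evidence X g S Y.
Proof.
have := evidence_ge0 X g0 S Y; have := evidence_le1 X mg g0 ig S Y.
by case: (evidence X g S Y).
Qed.

(** Each model's share of the posterior mass lies in [0, 1], so it is at most its square root;
    inside the root, [u S] bounds the numerator because G_S has mass 1. Only monotonicity is applied
    to the numerator, so [B] may be any set. *)
Lemma posterior_le (B : set 'cV[R]_p) Y (L0 : R) (u : {set 'I_p} -> R) :
  0 < L0 -> (L0%:E <= prior_int pi g (fun b => (lik X Y b)%:E))%E ->
  (forall S b, (forall i, i \notin S -> b i ord0 = 0) -> B b ->
     lik X Y b <= u S) ->
  (forall S, 0 <= u S) ->
  0 <= posterior X pi g B Y <= \sum_(S : {set 'I_p}) Num.sqrt (weight S * u S / L0).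
Proof.
move=> L00 denL likB u0.
pose N S := int_on S (fun b => ((\1_B b * lik X Y b)%:E * (prod_dens g S b)%:E)%E).
have N0 S : (0 <= N S)%E.
  by apply: int_on_ge0 => b; rewrite -EFinM lee_fin !mulr_ge0 ?lik_ge0 ?prod_dens_ge0.
have NE S : (N S <= evidence X g S Y)%E.
  apply: int_on_le => b _; rewrite -!EFinM !lee_fin indicE.
  case: (b \in B); rewrite ?mul0r ?mul1r ?lexx !mulr_ge0 ?lik_ge0 ?prod_dens_ge0//.
have Nu S : (N S <= (u S)%:E)%E.
  rewrite -[leRHS]mule1 -(int_prod_dens mg g0 ig S) -int_onZ//; last 2 first.
  - by move=> b; rewrite lee_fin prod_dens_ge0.
  - exact: vmeas_prod_dens.
  apply: int_on_le => b bS; rewrite -!EFinM !lee_fin indicE.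
  have [bB|_] := boolP (b \in B); last by rewrite !mul0r lexx mulr_ge0 ?prod_dens_ge0.
  rewrite mul1r mulr_ge0 ?lik_ge0 ?prod_dens_ge0//= ler_wpM2r ?prod_dens_ge0//.
  by apply: likB => //; exact: set_mem.
have fN S : (fine (N S))%:E = N S.
  have := N0 S; have := le_trans (NE S) (evidence_le1 X mg g0 ig S Y).
  by case: (N S).
have numE : fine (prior_int pi g (fun b => (\1_B b * lik X Y b)%:E)) =
    \sum_(S : {set 'I_p}) weight S * fine (N S).
  rewrite -[RHS]/(fine _%:E) -sumEFin; congr fine; apply: eq_bigr => S _.
  by rewrite [RHS]EFinM fN.
pose den := \sum_(S : {set 'I_p}) weight S * fine (evidence X g S Y).
have denE : prior_int pi g (fun b => (lik X Y b)%:E) = den%:E.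
  rewrite prior_intE -sumEFin; apply: eq_bigr => S _.
  by rewrite [RHS]EFinM fine_evidence.
rewrite /posterior numE denE /=.
have Lden : L0 <= den by rewrite denE lee_fin in denL.
have den0 : 0 < den by exact: lt_le_trans Lden.
have wN0 S : 0 <= weight S * fine (N S) by rewrite mulr_ge0 ?weight_ge0// fine_ge0.
apply/andP; split.
  by rewrite divr_ge0 ?(ltW den0)// sumr_ge0.
rewrite mulr_suml; apply: ler_sum => S _.
(* The share of the model [S] in the posterior mass of [B]. *)
set x := _ / den.
have x0 : 0 <= x by rewrite divr_ge0// (ltW den0).
have x1 : x <= 1.
  rewrite ler_pdivrMr// mul1r.
  apply: (@le_trans _ _ (weight S * fine (evidence X g S Y))).
    by rewrite ler_wpM2l ?weight_ge0// -lee_fin fN fine_evidence.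
  rewrite /den (bigD1 S)//= lerDl sumr_ge0// => T _.
  by rewrite mulr_ge0 ?weight_ge0// fine_ge0// evidence_ge0.
apply: (@le_trans _ _ (Num.sqrt x)).
  rewrite -[leLHS]ger0_norm// -sqrtr_sqr ler_wsqrtr// expr2.
  by rewrite ler_piMl.
rewrite ler_wsqrtr// /x.
apply: ler_pM => //; first by rewrite invr_ge0 ltW.
  by rewrite ler_wpM2l ?weight_ge0// -lee_fin fN.
by rewrite lef_pV2.
Qed.

End Posterior.

(** * Combining the bounds into posterior contraction *)

Section Contraction.
Local Open Scope classical_set_scope.
Variables (R : realType) (n p : nat) (X : 'M[R]_(n, p)).
Variables (pi : nat -> R) (g : R -> R).
Hypothesis pi0 : forall s, (s <= p)%N -> 0 <= pi s.
Hypothesis pi1 : \sum_(s < p.+1) pi s = 1.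
Hypothesis mg : measurable_fun setT g.
Hypothesis g0 : forall x, 0 <= g x.
Hypothesis ig : (\int[@lebesgue_measure R]_(x in setT) (g x)%:E = 1)%E.
Hypothesis sg : forall x, g (- x) = g x.
Variables beta0 betas : 'cV[R]_p.
Implicit Types (S : {set 'I_p}) (b : 'cV[R]_p) (Y W : 'cV[R]_n).

Lemma notin_supp b i : i \notin supp b -> b i ord0 = 0.
Proof. by rewrite inE negbK => /eqP. Qed.

(** If D is finite, the denominator is bounded below by its single term S = supp betas, to which
    [evidence_ge] applies. If D is infinite, the contraction threshold is infinite too. *)
Lemma Dbeta_cases : Dbeta X pi g betas = +oo%E \/
  exists2 d, 0 < d & Dbeta X pi g betas = d%:E /\
    forall Y, ((expR (- (sqnorm (Y - X *m betas)) / 2) / d)%:E <=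
      prior_int pi g (fun b => (lik X Y b)%:E))%E.
Proof.
rewrite /Dbeta; set S := supp betas.
case: eqVneq => [|piS0]; first by left.
have w0 : 0 < weight pi S.
  rewrite lt_def weight_ge0// andbT mulf_neq0// invr_neq0// pnatr_eq0.
  by rewrite -lt0n bin_gt0 card_le_p.
have -> : ('C(p, #|S|))%:R / pi #|S| = (weight pi S)^-1 by rewrite /weight invf_div.
rewrite /KL_shift -/(shift_klf g S betas).
set Kp := int_on S (fun b => maxe (shift_klf g S betas b) 0).
set Kn := int_on S (fun b => maxe (- shift_klf g S betas b) 0)%E.
rewrite -/(prod_dens g S).
set V := int_on S (fun b => (sqnorm (X *m b) * prod_dens g S b)%:E).
have Kp0 : (0 <= Kp)%E by apply: int_on_ge0 => b; rewrite le_max lexx orbT.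
have Kn0 : (0 <= Kn)%E by apply: int_on_ge0 => b; rewrite le_max lexx orbT.
have V0 : (0 <= V)%E.
  by apply: int_on_ge0 => b; rewrite lee_fin mulr_ge0 ?sqnorm_ge0 ?prod_dens_ge0.
have Kn1 : (Kn <= 1)%E := int_shift_klf_neg_le1 mg g0 ig S betas.
have fin_or_y (x : \bar R) : (0 <= x)%E -> (exists a, x = a%:E) \/ x = +oo%E.
  by case: x => [a _|_|//]; [left; exists a|right].
have Dy : ((weight pi S)^-1%:E * expeR +oo = +oo)%E.
  by rewrite /= gt0_muley// lte_fin invr_gt0.
(* The negative part is finite, so only [V] or [Kp] can be infinite, and either makes D infinite. *)
have [[kn KnE]|KnE] := fin_or_y _ Kn0; last by rewrite KnE in Kn1.
have [[v VE]|VE] := fin_or_y _ V0; last first.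
  left; rewrite VE gt0_muley ?lte_fin// addey ?Dy// KnE.
  by case: (Kp) Kp0.
have [[kp KpE]|KpE] := fin_or_y _ Kp0; last first.
  by left; rewrite KpE KnE VE -EFinM /= Dy.
right; exists ((weight pi S)^-1 * expR (kp - kn + v / 2)).
  by rewrite mulr_gt0 ?expR_gt0 ?invr_gt0.
split.
  by rewrite KpE KnE VE -EFinM (mulrC v).
move=> Y; rewrite prior_intE.
have ev := evidence_ge mg g0 ig sg (@notin_supp betas) Y KpE KnE VE.
rewrite (bigD1 S)//=.
apply: (@le_trans _ _ ((weight pi S)%:E * evidence X g S Y)%E); last first.
  rewrite leeDl// sume_ge0// => T _.
  by rewrite mule_ge0 ?evidence_ge0// lee_fin weight_ge0.
apply: le_trans (lee_wpmul2l _ ev); last by rewrite lee_fin ltW.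
rewrite -EFinM lee_fin invfM invrK mulrCA -expRN -expRD.
by rewrite le_eqVlt eqxx.
Qed.

(** Gram-Schmidt is applied to X betas and the columns of X indexed by [S]; the extra vector X betas
    explains the successor in the size bound. *)
Lemma exists_onb S : exists es : seq 'cV[R]_n,
  [/\ (size es <= #|S|.+1)%N, orthonormal es &
     forall b, (forall i, i \notin S -> b i ord0 = 0) ->
       spanned es (X *m (b - betas))].
Proof.
have [es [ses _ oes spes]] :=
  exists_orthonormal (X *m betas :: [seq col i X | i <- enum S]).
exists es; split => //; first by rewrite /= size_map -cardE in ses.
move=> b bS; rewrite mulmxBr -scaleN1r; apply: spannedD; last first.
  by apply: spannedZ; apply: spes; rewrite inE eqxx.
have -> : X *m b = \sum_(i in S) b i ord0 *: col i X.
  apply/matrixP => k j; rewrite (ord1 j) summxE mxE (bigID (mem S))/=.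
  rewrite [X in _ + X]big1 ?addr0; last by move=> i /bS ->; rewrite mulr0.
  by apply: eq_bigr => i _; rewrite !mxE mulrC.
apply: spanned_sum => i iS; apply: spannedZ; apply: spes.
by rewrite inE; apply/orP; right; apply/mapP; exists i; rewrite ?mem_enum.
Qed.

(** The log-likelihood ratio of b to betas is <nu, eps> - |mu|^2/2 + |mus|^2/2 with nu = mu - mus.
    The bound is written as a square because a square root of it is taken later. *)
Lemma lik_le S es Y b (M : R) : spanned es (X *m (b - betas)) ->
  0 <= M -> 7 * nrm (X *m (betas - beta0)) <= M -> M < nrm (X *m (b - beta0)) ->
  lik X Y b <= expR (- (sqnorm (Y - X *m betas)) / 2) *
   (expR (sqnorm (X *m (betas - beta0)) / 4 - M ^+ 2 / 32) *
    chisq_exp es 0 (Y - X *m beta0)) ^+ 2.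
Proof.
move=> spes M0 cM Mb.
set mus := X *m (betas - beta0) in cM *; set mu := X *m (b - beta0) in Mb *.
set eps := Y - X *m beta0.
have nuE : X *m (b - betas) = mu - mus.
  by rewrite -mulmxBr opprB addrA subrK.
rewrite nuE in spes.
have YbE : Y - X *m b = eps - mu by rewrite /eps /mu mulmxBr opprB addrA subrK.
have YsE : Y - X *m betas = eps - mus by rewrite /eps /mus mulmxBr opprB addrA subrK.
have sqE W : nrm W ^+ 2 = sqnorm W by rewrite sqr_sqrtr// sqnorm_ge0.
have M2 : M ^+ 2 <= sqnorm mu.
  by rewrite -sqE ler_pXn2r ?nnegrE ?sqrtr_ge0// ltW.
have c2 : 49 * sqnorm mus <= M ^+ 2.
  have := cM; rewrite -(@ler_pXn2r _ 2) ?nnegrE ?mulr_ge0 ?sqrtr_ge0//.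
  by rewrite exprMn sqE; lra.
have mu0 := sqnorm_ge0 mu; have h1 := sqnormB_le mu mus.
have h2 := spanned_dot_le eps spes.
have expR2 (z : R) : expR z ^+ 2 = expR (2 * z).
  by rewrite expr2 -expRD; congr expR; ring.
rewrite /lik /chisq_exp dot0l addr0 -expRD expR2 -expRD ler_expR.
rewrite YbE YsE !(sqnormB eps).
move: h2; rewrite dotDl dotNl (dotC eps mu) (dotC eps mus).
set q := \sum_(e <- es) _; set a1 := dot mu eps; set a2 := dot mus eps => h2.
(* After the bounds on <nu, eps> and |nu|^2, the coefficient of |mu|^2 is 8/21 - 1/2 = -5/42. Using
   |mus|^2 <= M^2/49 for the excess 8/3 |mus|^2 leaves -(5/42 - 8/147) M^2 = -19/294 M^2, below
   -M^2/16. *)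
lra.
Qed.

Lemma posterior_contraction (r : R) : 1 <= r ->
  (expect X beta0
     (posterior X pi g
        [set b | ((7 * nrm (X *m (betas - beta0)))%:E
                  + 4%:E * sqrt_log ((Cpi p pi ^+ 2)%:E * Dbeta X pi g betas)
                  + (8 * Num.sqrt r)%:E < (nrm (X *m (b - beta0)))%:E)%E])
   <= (2 * expR (- r))%:E)%E.
Proof.
move=> r1.
have C0 := Cpi_gt0 pi0 pi1.
have C20 : 0 < Cpi p pi ^+ 2 by rewrite exprn_gt0.
have [Dy|[d d0 [DE denE]]] := Dbeta_cases.
  (* Infinite D: the threshold is infinite, the event is empty and the posterior mass is 0. *)
  rewrite Dy gt0_muley ?lte_fin//= gt0_muley ?lte_fin//.
  rewrite (_ : [set b | _] = set0); last first.
    by apply/seteqP; split => b //=; rewrite addey// addye.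
  apply: (@le_trans _ _ 0%E); last by rewrite lee_fin mulr_ge0 ?expR_ge0.
  rewrite -(@iint0 R (iota 0 n) (fun=> 0)) le_eqVlt; apply/orP; left; apply/eqP.
  apply: eq_iint => w _; rewrite /posterior (_ : prior_int _ _ _ = 0%E) ?mul0r//.
  apply: big1 => S _; rewrite (_ : int_on _ _ = 0%E) ?mule0//.
  rewrite -[RHS](@iint0 R [seq val i | i <- enum S] (fun=> 0)).
  by apply: eq_iint => v _; rewrite indic0 mul0r mul0e.
rewrite DE -EFinM.
set c := nrm (X *m (betas - beta0)).
set l := Num.sqrt (ln (Cpi p pi ^+ 2 * d)).
set M := 7 * c + 4 * l + 8 * Num.sqrt r.
have r0 : 0 <= r by lra.
have c0 : 0 <= c := sqrtr_ge0 _.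
have l0 : 0 <= l := sqrtr_ge0 _.
have sr0 : 0 <= Num.sqrt r := sqrtr_ge0 _.
have M0 : 0 <= M by rewrite !addr_ge0// mulr_ge0.
have c2E : c ^+ 2 = sqnorm (X *m (betas - beta0)) by rewrite sqr_sqrtr// sqnorm_ge0.
have r2E : Num.sqrt r ^+ 2 = r by rewrite sqr_sqrtr.
have M2 : 49 * c ^+ 2 + 16 * l ^+ 2 + 64 * r <= M ^+ 2.
  have h1 := mulr_ge0 c0 l0; have h2 := mulr_ge0 c0 sr0; have h3 := mulr_ge0 l0 sr0.
  by rewrite /M; lra.
set B := [set b | _].
have [es_ esP] := choice exists_onb.
pose k := expR (c ^+ 2 / 4 - M ^+ 2 / 32).
pose A S := Num.sqrt (weight pi S * d) * k.
pose G S Y := chisq_exp (es_ S) 0 (Y - X *m beta0).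
have A0 S : 0 <= A S by rewrite mulr_ge0 ?sqrtr_ge0 ?expR_ge0.
have post_le Y : 0 <= posterior X pi g B Y <= \sum_S A S * G S Y.
  (* The likelihood at betas is a factor of both the numerator bound and the denominator bound e /
     d, so it cancels. *)
  pose e := expR (- (sqnorm (Y - X *m betas)) / 2).
  have e0 : 0 < e := expR_gt0 _.
  have u0 S : 0 <= e * (k * G S Y) ^+ 2.
    by rewrite mulr_ge0 ?(ltW e0)// exprn_ge0// mulr_ge0 ?expR_ge0.
  have likB S b : (forall i, i \notin S -> b i ord0 = 0) -> B b ->
      lik X Y b <= e * (k * G S Y) ^+ 2.
    move=> bS Bb; rewrite /k c2E; apply: lik_le => //.
    + by have [_ _] := esP S; apply.
    + by rewrite /M -addrA lerDl addr_ge0// mulr_ge0.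
  have := posterior_le pi0 mg g0 ig (divr_gt0 e0 d0) (denE Y) likB u0.
  case/andP=> -> /= h; apply: le_trans h _; apply: ler_sum => S _.
  rewrite /A le_eqVlt; apply/orP; left; apply/eqP.
  have -> : weight pi S * (e * (k * G S Y) ^+ 2) / (e / d) =
      weight pi S * d * (k * G S Y) ^+ 2 by field; rewrite !gt_eqF.
  have wd0 : 0 <= weight pi S * d by rewrite mulr_ge0 ?(weight_ge0 pi0) ?(ltW d0).
  rewrite sqrtrM// sqrtr_sqr ger0_norm ?mulrA//.
  by rewrite mulr_ge0 ?expR_ge0.
have gd0 w : 0 <= gauss_dens (X *m beta0) (vec n w).
  by rewrite mulr_ge0 ?expR_ge0 ?invr_ge0 ?exprn_ge0 ?sqrtr_ge0.
have mG S : cmeas (fun w => (G S (vec n w) * gauss_dens (X *m beta0) (vec n w))%:E).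
  apply: cmeas_EFin; apply: rmeasM; last exact: rmeas_gauss_dens.
  apply: rmeas_expR; apply: rmeasD; last exact: rmeas_dot.
  apply: rmeasM; first exact: rmeas_cst.
  by apply: rmeas_sum => e; apply: rmeasX; exact: rmeas_dot.
have G0 S w : (0 <= (G S (vec n w) * gauss_dens (X *m beta0) (vec n w))%:E)%E.
  by rewrite lee_fin mulr_ge0 ?expR_ge0.
apply: (@le_trans _ _ (\sum_(S : {set 'I_p}) (A S * 2 ^+ size (es_ S))%:E)%E).
  apply: (@le_trans _ _ (iint (iota 0 n) (fun w => \sum_(S : {set 'I_p})
      (A S)%:E * (G S (vec n w) * gauss_dens (X *m beta0) (vec n w))%:E)%E (fun=> 0))).
    apply: iint_le => w _; have /andP[p0 pA] := post_le (vec n w).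
    rewrite lee_fin mulr_ge0//=.
    under eq_bigr do rewrite -EFinM mulrA.
    by rewrite sumEFin lee_fin -mulr_suml ler_wpM2r.
  rewrite iint_sum => [|S w|S]; last 2 first.
  - by rewrite mule_ge0 ?lee_fin ?A0 // -lee_fin G0.
  - by move=> d' T t mt; apply: measurable_funeM; exact: mG.
  apply: lee_sum => S _; rewrite iintZ// expect_chisq_exp; last by have [] := esP S.
  rewrite -EFinM lee_fin sqnormE dot0l mul0r add0r big1 ?mulr0 ?expR0 ?mulr1//.
  by move=> e _; rewrite dot0l expr0n.
rewrite sumEFin lee_fin.
(* By [M2] the exponent is at most -41/32 c^2 - l^2/2 - 2r. *)
have kle : k <= expR (- (l ^+ 2 / 2)) * expR (- r).
  by have := sqr_ge0 c; rewrite -expRD ler_expR; lra.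
apply: (@le_trans _ _ (\sum_(S : {set 'I_p})
    (9 ^+ #|S| * Num.sqrt (weight pi S)) * (2 * Num.sqrt d * k))).
  apply: ler_sum => S _; rewrite /A sqrtrM ?(weight_ge0 pi0)//.
  (* The possible extra dimension coming from X betas yields the final constant 2. *)
  have s2 : 2 ^+ size (es_ S) <= 2 * 9 ^+ #|S| :> R.
    have [sz _ _] := esP S.
    apply: (@le_trans _ _ (2 ^+ #|S|.+1)); first by rewrite ler_weXn2l// ler1n.
    by rewrite exprS ler_pM2l// lerXn2r ?nnegrE//; lra.
  rewrite (_ : _ * (2 * _ * k) =
      Num.sqrt (weight pi S) * Num.sqrt d * k * (2 * 9 ^+ #|S|)).
    by rewrite ler_wpM2l// !mulr_ge0 ?sqrtr_ge0 ?expR_ge0.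
  by ring.
rewrite -mulr_suml -Cpi_weight//.
have Cd0 : 0 < Cpi p pi ^+ 2 * d by rewrite mulr_gt0.
have Cd : Cpi p pi * Num.sqrt d <= expR (l ^+ 2 / 2).
  rewrite -(@ler_pXn2r _ 2) ?nnegrE ?expR_ge0 ?mulr_ge0 ?sqrtr_ge0 ?(ltW C0)//.
  rewrite exprMn sqr_sqrtr ?(ltW d0)// -expRM_natl.
  rewrite -[leLHS]lnK ?posrE// ler_expR.
  (* If the logarithm is negative, [Num.sqrt] gives l = 0, and ln(C_pi^2 D) <= l^2 still holds. *)
  have [h|h] := leP 0 (ln (Cpi p pi ^+ 2 * d)).
    by rewrite /l sqr_sqrtr//; lra.
  by have := sqr_ge0 l; lra.
have -> : Cpi p pi * (2 * Num.sqrt d * k) = 2 * ((Cpi p pi * Num.sqrt d) * k) by ring.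
rewrite ler_pM2l//.
apply: (@le_trans _ _ (expR (l ^+ 2 / 2) * (expR (- (l ^+ 2 / 2)) * expR (- r)))).
  by rewrite ler_pM ?expR_ge0 ?mulr_ge0 ?sqrtr_ge0 ?(ltW C0).
by rewrite mulrA -expRD subrr expR0 mul1r.
Qed.

End Contraction.

Theorem theorem8 (R : realType) :
  exists C : R,
  forall (n p : nat) (X : 'M[R]_(n, p)) (pi : nat -> R) (g : R -> R),
    (forall s, (s <= p)%N -> 0 <= pi s) ->
    \sum_(s < p.+1) pi s = 1 ->
    measurable_fun setT g ->
    (forall x, 0 <= g x) ->
    (\int[@lebesgue_measure R]_(x in setT) (g x)%:E = 1)%E ->
    (forall x, g (- x) = g x) ->
  forall (beta0 betas : 'cV[R]_p) (r : R), 1 <= r ->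
    (expect X beta0
       (posterior X pi g
          [set b | ((7 * nrm (X *m (betas - beta0)))%:E
                    + 4%:E * sqrt_log ((Cpi p pi ^+ 2)%:E * Dbeta X pi g betas)
                    + (8 * Num.sqrt r)%:E < (nrm (X *m (b - beta0)))%:E)%E])
     <= (C * expR (- r))%:E)%E.
Proof.
exists 2 => n p X pi g pi0 pi1 mg g0 ig sg beta0 betas r r1.
exact: posterior_contraction.
Qed.
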